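(* Let $\mathcal H_A,\mathcal H_B$ be Hilbert spaces, let $|\psi\rangle\in\mathcal H_A\otimes\mathcal H_B$ be a unit vector, let $A_0,A_1$ be operators on $\mathcal H_A$ that are Hermitian and unitary, and let $B_{y_1}$, $B_{y_1,y_2}$ ($y_1,y_2\in\{0,1\}$) be operators on $\mathcal H_B$ that are Hermitian and unitary and satisfy $[B_{y_1},B_{y_1,y_2}]=0$ for all $y_1,y_2\in\{0,1\}$. Write $\langle X\rangle=\langle\psi|X|\psi\rangle$ and define $$S_1=(A_0+A_1)B_0+(A_0-A_1)B_1,\qquad S_2=(A_0+A_1)B_{0,0}+(A_0-A_1)B_{0,1},$$ $$S_c=(A_0+A_1)B_{0,0}+(A_0-A_1)B_1,$$ $$S_\theta=\cos 2\theta\,(S_1-\sqrt2\,\mathbb 1)+\sin 2\theta\,(S_2-\sqrt2\,\mathbb 1)\qquad(\theta\in\mathbb R).$$ Then $$\langle S_c\rangle=2\sqrt2\ \Longrightarrow\ \langle S_\theta\rangle\le\sqrt2\quad\text{for all }\theta\in\mathbb R.$$ Moreover the inequality can be saturated: for every $\theta\in\mathbb R$ there exist Hilbert spaces $\mathcal H_A,\mathcal H_B$, a unit vector $|\psi\rangle\in\mathcal H_A\otimes\mathcal H_B$, Hermitian unitary operators $A_0,A_1$ on $\mathcal H_A$ and Hermitian unitary operators $B_{y_1}$, $B_{y_1,y_2}$ ($y_1,y_2\in\{0,1\}$) on $\mathcal H_B$ with $[B_{y_1},B_{y_1,y_2}]=0$ for all $y_1,y_2\in\{0,1\}$, such that $\langle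 S_c\rangle=2\sqrt2$ and $\langle S_\theta\rangle=\sqrt2$.
   Context: Scenario: Alice (input $x\in\{0,1\}$, output $a=\pm1$) and two sequential parties Bob$_1$, Bob$_2$ (inputs $y_1,y_2\in\{0,1\}$, outputs $b_1,b_2=\pm1$), where Bob$_1$ may communicate to Bob$_2$ but not conversely. A sequential quantum correlation in this scenario is a family $p(a,b_1,b_2|x,y_1,y_2)=\langle\psi|\Lambda^x_a\otimes\Pi^{y_1}_{b_1}\Pi^{y_1,y_2}_{b_2}|\psi\rangle$, where $\Lambda^x_a$, $\Pi^{y_1}_{b_1}$, $\Pi^{y_1,y_2}_{b_2}$ are the projectors onto the eigenspaces (with eigenvalues $a$, $b_1$, $b_2$) of operators $A_x$, $B_{y_1}$, $B_{y_1,y_2}$ as in the claim. Products such as $A_xB_{y_1}$ mean $A_x\otimes B_{y_1}$; $\mathbb 1$ is the identity. The Hilbert spaces have arbitrary dimension. *)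

(* Defs.v *)
From HB Require Import structures.
From mathcomp Require Import all_boot all_order all_algebra.
From mathcomp Require Import complex.
From mathcomp Require Import all_classical all_reals all_analysis.

Set Implicit Arguments.
Unset Strict Implicit.
Unset Printing Implicit Defensive.

Import Order.TTheory GRing.Theory Num.Theory.
Import numFieldNormedType.Exports.
Local Open Scope classical_set_scope.
Local Open Scope ring_scope.
Local Open Scope complex_scope.

(* Complex Hilbert spaces of arbitrary dimension.  [dot] is linear in its first
   argument and conjugate-linear in the second: the bra-ket <u|v> is [dot v u].
   Completeness is that of the norm induced by [dot]. *)
HB.mixin Record NormedModule_isHilbert (R : realType) H
    of CompleteNormedModule R[i] H := {
  dot : {dot H for @Num.conj R[i]} ;
  dot_norm : forall u : H, `|u| ^+ 2 = dot u u
}.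

#[short(type="hilbertType")]
HB.structure Definition Hilbert (R : realType) :=
  {H of NormedModule_isHilbert R H & CompleteNormedModule R[i] H}.

(* A Hilbert space tensor product of HA and HB.  Such a structure exists for all
   HA and HB, and any two are related by a unique unitary identifying the
   elementary tensors, so that statements about it do not depend on the choice
   of a model. *)
Record hilbertTensor (R : realType) (HA HB : hilbertType R) := HilbertTensor {
  tensor_space :> hilbertType R ;
  tensor : {bilinear HA -> HB -> tensor_space} ;
  dot_tensor : forall a b a' b',
    dot (tensor a b) (tensor a' b') = dot a a' * dot b b' ;
  dense_tensor : dense [set u | exists n (a : 'I_n -> HA) (b : 'I_n -> HB),
    u = \sum_i tensor (a i) (b i)]
}.

Section Operators.
Context {R : realType} {H : hilbertType R}.
Implicit Types X Y : H -> H.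

Definition adjoint_of X Y := forall u v, dot (X u) v = dot u (Y v).

Definition hermitian_op X := adjoint_of X X.

Definition unitary_op X :=
  exists Xadj, [/\ adjoint_of X Xadj, cancel X Xadj & cancel Xadj X].

Definition commutator X Y : H -> H := (X \o Y) \- (Y \o X).

Definition expval (psi : H) X : R[i] := dot (X psi) psi.

End Operators.

Section Tensor.
Context {R : realType} {HA HB : hilbertType R} (T : hilbertTensor HA HB).

(* The unique bounded operator acting on elementary tensors as A on the first
   factor and as B on the second.  It exists for all bounded linear A and B; the
   default value [idfun] only serves to make the definition total. *)
Definition tensor_op (A : HA -> HA) (B : HB -> HB) : T -> T :=
  xget (idfun : {classic (T -> T)})
    [set X : T -> T | [/\ linear X, continuous X &
      forall a b, X (tensor T a b) = tensor T (A a) (B b)]].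

Definition chsh (A : 'I_2 -> {linear HA -> HA}) (B B' : HB -> HB) : T -> T :=
  tensor_op (A 0 \+ A 1) B \+ tensor_op (A 0 \- A 1) B'.

(* Boundedness of the operators is not assumed separately: a unitary linear map
   is isometric. *)
Definition sequential_model (psi : T) (A : 'I_2 -> {linear HA -> HA})
    (B1 : 'I_2 -> {linear HB -> HB}) (B2 : 'I_2 -> 'I_2 -> {linear HB -> HB}) :=
  [/\ `|psi| = 1,
      forall x, hermitian_op (A x) /\ unitary_op (A x),
      forall y1, hermitian_op (B1 y1) /\ unitary_op (B1 y1),
      forall y1 y2, hermitian_op (B2 y1 y2) /\ unitary_op (B2 y1 y2) &
      forall y1 y2, commutator (B1 y1) (B2 y1 y2) =1 \0].

Variables (A : 'I_2 -> {linear HA -> HA}) (B1 : 'I_2 -> {linear HB -> HB})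
  (B2 : 'I_2 -> 'I_2 -> {linear HB -> HB}).

Definition S_1 := chsh A (B1 0) (B1 1).
Definition S_2 := chsh A (B2 0 0) (B2 0 1).
Definition S_c := chsh A (B2 0 0) (B1 1).

Definition S_ (theta : R) : T -> T :=
  (cos (2 * theta))%:C \*: (S_1 \- (Num.sqrt 2)%:C \*: idfun) \+
  (sin (2 * theta))%:C \*: (S_2 \- (Num.sqrt 2)%:C \*: idfun).

End Tensor.

(* Main.v *)
Require Import Defs.
From HB Require Import structures.
From mathcomp Require Import all_boot all_order all_algebra complex mxtens.
From mathcomp Require Import all_classical all_reals all_analysis ring lra.

Set Implicit Arguments.
Unset Strict Implicit.
Unset Printing Implicit Defensive.

Import Order.TTheory GRing.Theory Num.Theory.
Import numFieldNormedType.Exports.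
Local Open Scope ring_scope.
Local Open Scope complex_scope.

(* With Z = (A_0 + A_1)/sqrt 2 and X = (A_0 - A_1)/sqrt 2 one has
   ZX + XZ = 0 and Z^2 + X^2 = 2, so that
     sqrt 2 (2 sqrt 2 - S_c) = (Z - B_{0,0})^2 + (X - B_1)^2.
   Maximality of <S_c> thus gives Z psi = B_{0,0} psi and X psi = B_1 psi, whence
   <S_theta> = sqrt 2 <w, psi> for
     w = cos 2theta Z B_0 psi + sin 2theta X B_{0,1} psi.
   Since B_0 and B_{0,1} commute while Z and X anticommute, the cross terms of
   |w|^2 cancel and w is a unit vector; hence <w, psi> <= 1.

   Saturation: psi = (|00> + |11>)/sqrt 2 tensored with |0> on Bob's side,
   Z = sigma_z, X = sigma_x, B_{0,0} = sigma_z (x) 1, B_1 = sigma_x (x) 1,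
   B_0 = sigma_z (x) U and B_{0,1} = sigma_x (x) V, where
   U = cos 2theta sigma_z + sin 2theta sigma_x and
   V = sin 2theta sigma_z - cos 2theta sigma_x anticommute. *)

(** * Extension of isometric linear relations *)

Section IsometricExtension.
Local Open Scope classical_set_scope.
Context {K : numFieldType} {V : normedModType K} {W : completeNormedModType K}.
(** [G] is the graph of a partial linear map, kept as a relation because a vector may be presented
    in several ways, e.g. as a sum of elementary tensors. That the image does not depend on the
    presentation is a consequence of linearity and isometry. *)
Variable G : V -> W -> Prop.
Hypothesis G_linear : forall k u v u' v',
  G u v -> G u' v' -> G (k *: u + u') (k *: v + v').
Hypothesis G_isometric : forall u v, G u v -> `|v| = `|u|.
Hypothesis G_dense : dense [set u | exists v, G u v].

(** The closure of the graph [G] in the product of [V] and [W]; it turns out to be the graph of the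
    extension. *)
Let E (u : V) (v : W) := forall e : K, 0 < e ->
  exists w w', [/\ G w w', `|u - w| < e & `|v - w'| < e].

(** The sets [A e] of images of [e]-approximations of [u] generate a filter. It is Cauchy because
    [G] preserves distances, so it converges in the complete space [W], and its limit is the image
    of [u]. *)
Let E_total u : exists v, E u v.
Proof.
pose A (e : K) := [set w' | exists2 w, G w w' & `|u - w| < e].
pose F := filter_from [set e : K | 0 < e] A.
have A0 e : 0 < e -> A e !=set0.
  move=> e0.
  have [|w [uw [w' Gw]]] := @G_dense (ball u e) _ (ball_open u e).
    by exists u; exact: ballxx.
  by exists w'; exists w => //; move: uw; rewrite -ball_normE.
have FF : ProperFilter F.
  apply: filter_from_proper => //; apply: filter_from_filter.
    by exists 1 => /=.
  (* [K] is only partially ordered, but its positive elements are real and therefore comparable. *)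
  move=> i j /= i0 j0; have [ij|ji] := real_leP (gtr0_real i0) (gtr0_real j0).
    exists i => // w' [w Gw uw]; split; exists w => //; exact: lt_le_trans ij.
  exists j => // w' [w Gw uw]; split; exists w => //; exact: lt_trans ji.
have Fc : cauchy F.
  apply: cauchy_exP => e e0; have e2 : 0 < e / 2 by rewrite divr_gt0.
  have [w' [w Gw uw]] := A0 _ e2; exists w'; exists (e / 2) => // z' [z Gz uz].
  rewrite -ball_normE /=.
  have /G_isometric : G ((-1) *: z + w) ((-1) *: z' + w') by exact: G_linear.
  rewrite !scaleN1r ![- _ + _]addrC => ->.
  rewrite -(subrKA u w) (splitr e) (le_lt_trans (ler_normD _ _))//.
  by rewrite ltrD// distrC.
have /cvg_ex[v Fv] : cvg F by exact: cauchy_cvg.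
exists v => e e0.
have Fe : F (A e) by exists e.
have /cvgrPdist_lt/(_ _ e0) Fb : (id : W -> W) x @[x --> F] --> v by [].
by have [w' [[w Gw uw] vw]] := filter_ex (filterI Fe Fb); exists w, w'.
Qed.

Let E_linear k u v u' v' : E u v -> E u' v' -> E (k *: u + u') (k *: v + v').
Proof.
move=> Eu Eu' e e0.
have k0 : 0 < `|k| + 1 by rewrite ltr_wpDl.
(* This precision d is chosen so that [|k| * d + d = e]. *)
have d0 : 0 < e / (`|k| + 1) by rewrite divr_gt0.
have [w [z [Gw uw vz]]] := Eu _ d0; have [w' [z' [Gw' uw' vz']]] := Eu' _ d0.
have aux (U : normedModType K) (x y x' y' : U) : `|x - y| < e / (`|k| + 1) ->
    `|x' - y'| < e / (`|k| + 1) -> `|k *: x + x' - (k *: y + y')| < e.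
  move=> xy xy'; rewrite opprD addrACA -scalerBr (le_lt_trans (ler_normD _ _))//.
  have -> : e = `|k| * (e / (`|k| + 1)) + e / (`|k| + 1).
    by rewrite -{2}(mul1r (e / _)) -mulrDl mulrC divfK ?gt_eqF.
  by rewrite ler_ltD// normrZ ler_wpM2l// ltW.
by exists (k *: w + w'), (k *: z + z'); split; [exact: G_linear| exact: aux..].
Qed.

Let E_isometric u v : E u v -> `|v| = `|u|.
Proof.
move=> Euv; have tri (U : normedModType K) (x y : U) : `|x| <= `|y| + `|x - y|.
  by rewrite -{1}(subrKC y x) ler_normD.
apply/eqP; rewrite eq_le; apply/andP; split; apply/ler_addgt0Pr => e e0;
  have e2 : 0 < e / 2 by rewrite divr_gt0.
  have [w [w' [/G_isometric ww uw vw]]] := Euv _ e2.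
  rewrite (le_trans (tri _ _ w'))// (splitr e) addrA lerD ?(ltW vw)// ww.
  by rewrite (le_trans (tri _ _ u))// lerD2l distrC ltW.
have [w [w' [/G_isometric ww uw vw]]] := Euv _ e2.
rewrite (le_trans (tri _ _ w))// (splitr e) addrA lerD ?(ltW uw)// -ww.
by rewrite (le_trans (tri _ _ v))// lerD2l distrC ltW.
Qed.

(** By linearity [E] relates 0 to the difference of the two images, which by isometry has norm 0. *)
Let E_inj u v v' : E u v -> E u v' -> v = v'.
Proof.
move=> Ev Ev'; apply/eqP; rewrite -subr_eq0 -normr_eq0.
have /E_isometric : E ((-1) *: u + u) ((-1) *: v' + v) by exact: E_linear.
by rewrite !scaleN1r addNr addrC normr0 => ->.
Qed.

Lemma isometric_extension : exists f : V -> W,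
  [/\ linear f, continuous f, forall u, `|f u| = `|u| &
      forall u v, G u v -> f u = v].
Proof.
have [f fE] := choice E_total.
have f_linear : linear f.
  by move=> k u v; apply: (E_inj (fE _)); exact: E_linear.
have fB u v : f (u - v) = f u - f v.
  by rewrite addrC -scaleN1r f_linear scaleN1r addrC.
exists f; split=> // [u|u|u v Guv]; last 1 first.
- by apply: (E_inj (fE u)) => e e0; exists u, v; rewrite !subrr !normr0.
- apply/cvgrPdist_lt => e e0; near=> v.
  rewrite -fB (E_isometric (fE _)); near: v.
  exact: cvgr_dist_lt.
- exact: E_isometric (fE u).
Unshelve. all: by end_near. Qed.

End IsometricExtension.

Lemma linear_fun_sum (K : nzRingType) (U V : lmodType K) (f : U -> V)
    (I : finType) (F : I -> U) :
  linear f -> f (\sum_i F i) = \sum_i f (F i).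
Proof.
move=> fl; pose fL := GRing.isLinear.Build _ _ _ _ f fl.
pose g : {linear U -> V} := HB.pack f fL.
exact: (linear_sum g).
Qed.

(** * Inner products, self-adjoint unitaries and polarization *)

Section Hilbert.
Context {R : realType} {H : hilbertType R}.
Implicit Types (u v w : H) (X : H -> H).

Lemma dotC u v : dot u v = Num.conj (dot v u).
Proof. by rewrite hermC expr0 mul1r. Qed.

Lemma dotDl u v w : dot (u + v) w = dot u w + dot v w.
Proof. exact: linearDl. Qed.

Lemma dotDr u v w : dot u (v + w) = dot u v + dot u w.
Proof. exact: linearDr. Qed.

Lemma dotBl u v w : dot (u - v) w = dot u w - dot v w.
Proof. exact: linearBl. Qed.

Lemma dotBr u v w : dot u (v - w) = dot u v - dot u w.
Proof. exact: linearBr. Qed.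

Lemma dotZl k u v : dot (k *: u) v = k * dot u v.
Proof. exact: linearZl_LR. Qed.

Lemma dotZr k u v : dot u (k *: v) = Num.conj k * dot u v.
Proof. exact: linearZr_LR. Qed.

Lemma dot_sum (I J : finType) (u : I -> H) (v : J -> H) :
  dot (\sum_i u i) (\sum_j v j) = \sum_i \sum_j dot (u i) (v j).
Proof.
rewrite [LHS](linear_sumlz (@dot R H)); apply: eq_bigr => i _.
exact: linear_sumr.
Qed.

(** A Hermitian [X] and the inverse provided by unitarity are both adjoint to [X], hence equal:
    their difference at any vector is orthogonal to itself. *)
Lemma hermitian_unitary_involutive X :
  hermitian_op X -> unitary_op X -> involutive X.
Proof.
move=> hX [Y [XY YK XK]] u; rewrite -[in RHS](YK u).
apply/eqP; rewrite -subr_eq0 -(dnorm_eq0 (@dot R H)) linearBr /=.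
by rewrite -hX -XY subrr.
Qed.

Lemma hermitian_involutive_isometric X :
  hermitian_op X -> involutive X -> forall u v, dot (X u) (X v) = dot u v.
Proof. by move=> hX iX u v; rewrite hX iX. Qed.

Lemma conjC_complex (x : R) : Num.conj x%:C = x%:C.
Proof. by apply: conj_Creal; rewrite complex_real. Qed.

(** Polarization: expanding the norm of [u + v] shows that [dot u v + dot v u] is preserved. *)
Lemma linear_isometry_dot X : linear X -> (forall u, `|X u| = `|u|) ->
  forall u v, dot (X u) (X v) = dot u v.
Proof.
move=> lX nX.
have D u v : X (u + v) = X u + X v by rewrite -[u]scale1r lX !scale1r.
have dE u : dot (X u) (X u) = dot u u by rewrite -!dot_norm nX.
have ReE u v : dot (X u) (X v) + dot (X v) (X u) = dot u v + dot v u.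
  have := dE (u + v); rewrite D !(dotDl, dotDr) !dE => /eqP.
  by rewrite !addrA (inj_eq (addIr _)) -!addrA (inj_eq (addrI _)) => /eqP.
(* Replacing [u] by ['i *: u] turns the symmetric sum into ['i] times [dot u v - dot v u]; the sum
   and the difference together determine [dot u v]. *)
move=> u v; have := ReE u v; have := ReE ('i%C *: u) v.
have -> : X ('i%C *: u) = 'i%C *: X u.
  have X0 : X 0 = 0 by apply: (addrI (X 0)); rewrite -D !addr0.
  by rewrite -[_ *: u]addr0 lX X0 addr0.
rewrite !(dotZl, dotZr) complexiE conjCi !mulNr -!mulrBr.
move=> /(mulfI (neq0Ci _)) h1 h2; apply: (mulIf (_ : 2 != 0)) => //.
have E (x y : R[i]) : x * 2 = x - y + (x + y).
  by rewrite mulr_natr mulr2n addrACA addNr addr0.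
by rewrite (E _ (dot (X v) (X u))) h1 h2 -E.
Qed.

End Hilbert.

(** * Operators on Hilbert tensor products *)

Section TensorOperator.
Local Open Scope classical_set_scope.
Context {R : realType} {HA HB : hilbertType R} (T : hilbertTensor HA HB).
Implicit Types (A : HA -> HA) (B : HB -> HB) (X Y : T -> T).

Definition represents_tensor A B X := [/\ linear X, continuous X &
  forall a b, X (tensor T a b) = tensor T (A a) (B b)].

(** The set where [X] and [Y] differ is open, so if nonempty it would meet the dense span of
    elementary tensors, on which they agree. Algebraic identities between operators on [T] are all
    obtained from this uniqueness. *)
Lemma represents_tensor_unique A B X Y :
  represents_tensor A B X -> represents_tensor A B Y -> X = Y.
Proof.
move=> [lX cX XE] [lY cY YE]; apply/funext => u; apply: contrapT => XYu.
have oD : open [set v | X v - Y v != 0].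
  have -> : [set v | X v - Y v != 0] = (X \- Y) @^-1` (~` [set 0]).
    by apply/seteqP; split => v /= /eqP.
  apply: open_comp; first by move=> v _; exact: (continuousB (cX v) (cY v)).
  by apply: closed_openC; apply: accessible_closed_set1;
    apply: hausdorff_accessible; exact: norm_hausdorff.
have [|v [/=]] := dense_tensor _ oD.
  by exists u; rewrite /= subr_eq0; apply/eqP.
move=> /[swap] -[n [a [b ->]]].
have -> : X (\sum_i tensor T (a i) (b i)) = Y (\sum_i tensor T (a i) (b i)).
  by rewrite !linear_fun_sum//; apply: eq_bigr => i _; rewrite XE YE.
by rewrite subrr eqxx.
Qed.

Lemma tensor_opE A B X : represents_tensor A B X -> tensor_op A B = X.
Proof.
move=> XE; apply: xget_subset1 => // Y Z YE ZE.
exact: represents_tensor_unique YE ZE.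
Qed.

Lemma represents_tensor_comp A A' B B' X X' : represents_tensor A B X ->
  represents_tensor A' B' X' -> represents_tensor (A \o A') (B \o B') (X \o X').
Proof.
move=> [lX cX XE] [lX' cX' X'E]; split => [k u v|u|a b] /=.
- by rewrite lX' lX.
- by apply: continuous_comp; [exact: cX'|exact: cX].
- by rewrite X'E XE.
Qed.

Lemma represents_tensor_id : represents_tensor idfun idfun idfun.
Proof. by split=> // u; exact: cvg_id. Qed.

Lemma represents_tensorD A A' B X X' : represents_tensor A B X ->
  represents_tensor A' B X' -> represents_tensor (A \+ A') B (X \+ X').
Proof.
move=> [lX cX XE] [lX' cX' X'E]; split => [k u v|u|a b] /=.
- by rewrite lX' lX scalerDr addrACA.
- exact: continuousD (cX u) (cX' u).
- by rewrite X'E XE linearDl.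
Qed.

Lemma represents_tensorB A A' B X X' : represents_tensor A B X ->
  represents_tensor A' B X' -> represents_tensor (A \- A') B (X \- X').
Proof.
move=> [lX cX XE] [lX' cX' X'E]; split => [k u v|u|a b] /=.
- by rewrite lX' lX scalerBr opprD addrACA.
- exact: continuousB (cX u) (cX' u).
- by rewrite X'E XE linearBl.
Qed.

Let split_sum n m (a : 'I_n -> HA) (b : 'I_n -> HB)
    (a' : 'I_m -> HA) (b' : 'I_m -> HB) (f : HA -> HB -> T) :
  \sum_i f (match fintype.split i with inl j => a j | inr j => a' j end)
           (match fintype.split i with inl j => b j | inr j => b' j end) =
  \sum_i f (a i) (b i) + \sum_i f (a' i) (b' i).
Proof.
rewrite big_split_ord /=; congr (_ + _); apply: eq_bigr => i _.
  by rewrite -[lshift _ _]/(unsplit (inl i)) unsplitK.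
by rewrite -[rshift _ _]/(unsplit (inr i)) unsplitK.
Qed.

(** The relation sending a sum of elementary tensors to the sum of their images is linear, densely
    defined, and isometric because the Gram matrix of elementary tensors is preserved;
    [isometric_extension] then applies. *)
Lemma represents_tensor_exists (A : {linear HA -> HA}) (B : {linear HB -> HB}) :
  (forall a a', dot (A a) (A a') = dot a a') ->
  (forall b b', dot (B b) (B b') = dot b b') ->
  exists2 X, represents_tensor A B X & forall u, `|X u| = `|u|.
Proof.
move=> iA iB.
pose G (u v : T) := exists n (a : 'I_n -> HA) (b : 'I_n -> HB),
  u = \sum_i tensor T (a i) (b i) /\ v = \sum_i tensor T (A (a i)) (B (b i)).
have [k u v u' v'|u v|O|X [lX cX nX XE]] := @isometric_extension _ T T G.
- move=> [n [a [b [-> ->]]]] [m [a' [b' [-> ->]]]].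
  exists (n + m)%N,
    (* The two families are concatenated, and the scalar [k] is absorbed into the first factor. *)
    (fun i => match fintype.split i with inl j => k *: a j | inr j => a' j end),
    (fun i => match fintype.split i with inl j => b j | inr j => b' j end).
  rewrite (split_sum _ _ _ _ (tensor T)).
  rewrite (split_sum _ _ _ _ (fun x y => tensor T (A x) (B y))).
  rewrite !scaler_sumr; split; congr (_ + _); apply: eq_bigr => i _.
    by rewrite linearZl_LR.
  by rewrite linearZ /= linearZl_LR.
- move=> [n [a [b [-> ->]]]]; apply/eqP.
  rewrite -(@eqrXn2 _ 2)// !dot_norm !dot_sum; apply/eqP.
  apply: eq_bigr => i _; apply: eq_bigr => j _.
  by rewrite !dot_tensor iA iB.
- move=> O0 oO; have [v [Ov [n [a [b vE]]]]] := dense_tensor O0 oO.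
  by exists v; split=> //; exists (\sum_i tensor T (A (a i)) (B (b i))), n, a, b.
exists X => //; split => // a b; apply: XE; exists 1%N, (fun=> a), (fun=> b).
by rewrite !big_ord1.
Qed.

End TensorOperator.

(** * The bound *)

Section AbstractBound.
Context {R : realType} {H : hilbertType R}.
(** On the tensor product, [a0] and [a1] stand for A_0 and A_1, and [m], [n], [b], [p] for B_{0,0},
    B_1, B_0, B_{0,1}. The letter [s] below is the square root of 2. *)
Variables (a0 a1 m n b p : {linear H -> H}) (psi : H).
Let sym (X : H -> H) := hermitian_op X /\ involutive X.
Hypotheses (a0_sym : sym a0) (a1_sym : sym a1) (m_sym : sym m) (n_sym : sym n)
  (b_sym : sym b) (p_sym : sym p).
Hypotheses (a0b : forall u, a0 (b u) = b (a0 u))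
  (a1b : forall u, a1 (b u) = b (a1 u)) (a0p : forall u, a0 (p u) = p (a0 u))
  (a1p : forall u, a1 (p u) = p (a1 u)) (bp : forall u, b (p u) = p (b u)).
Hypothesis psi1 : dot psi psi = 1.
Let s : R[i] := (Num.sqrt 2)%:C.
Hypothesis chsh_max :
  dot (a0 (m psi) + a1 (m psi) + (a0 (n psi) - a1 (n psi))) psi = 2 * s.

Let sJ : Num.conj s = s.
Proof. exact: conjC_complex. Qed.

Let ss : s * s = 2.
Proof. by rewrite /s -rmorphM /= -expr2 sqr_sqrtr// rmorph_nat. Qed.

Let s0 : s != 0.
Proof. by apply/eqP => s0; have /eqP := ss; rewrite s0 mul0r eq_sym pnatr_eq0. Qed.

Let dot_isom (X : {linear H -> H}) :
  sym X -> forall u v, dot (X u) (X v) = dot u v.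
Proof. by move=> [hX iX]; exact: hermitian_involutive_isometric. Qed.

Let isomE := (dot_isom a0_sym, dot_isom a1_sym, dot_isom m_sym,
  dot_isom n_sym, dot_isom b_sym, dot_isom p_sym).

(** With [P] and [Q] the two right-hand sides, the parallelogram law gives total squared norm 4. The
    squared norms of [s *: m psi - P] and [s *: n psi - Q] then add up to
    [2 * s ^+ 2 + 4 - 2 * s * (2 * s) = 0], so both vectors vanish. *)
Let self_test : s *: m psi = a0 psi + a1 psi /\ s *: n psi = a0 psi - a1 psi.
Proof.
move: (erefl (a0 psi + a1 psi)) (erefl (a0 psi - a1 psi)).
move: {1 3}(a0 psi + a1 psi) {1 3}(a0 psi - a1 psi) => P Q PE QE.
have PQ : dot P P + dot Q Q = 4.
  rewrite PE QE !(dotBl, dotBr, dotDl, dotDr) !isomE psi1. ring.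
have cross : dot (m psi) P + dot (n psi) Q = 2 * s.
  rewrite PE QE -chsh_max !(dotBl, dotBr, dotDl, dotDr).
  by rewrite (proj1 a0_sym) (proj1 a0_sym (n _)) !(proj1 a1_sym).
have crossJ : dot P (m psi) + dot Q (n psi) = 2 * s.
  transitivity (Num.conj (2 * s)); first by rewrite -cross rmorphD /= -!dotC.
  by rewrite rmorphM /= sJ rmorph_nat.
have nP := dnorm_ge0 (@dot R H) (s *: m psi - P).
have nQ := dnorm_ge0 (@dot R H) (s *: n psi - Q).
have : dot (s *: m psi - P) (s *: m psi - P)
     + dot (s *: n psi - Q) (s *: n psi - Q) == 0.
  rewrite !(dotBl, dotBr, dotZl, dotZr) sJ !isomE psi1; apply/eqP.
  transitivity (s * s * 2 + (dot P P + dot Q Q)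
    - s * (dot (m psi) P + dot (n psi) Q) - s * (dot P (m psi) + dot Q (n psi))).
    by ring.
  rewrite PQ cross crossJ; transitivity (4 - s * s * 2 : R[i]); first by ring.
  by rewrite ss; ring.
rewrite paddr_eq0// !(dnorm_eq0 (@dot R H)) !subr_eq0 => /andP[/eqP ? /eqP ?].
by [].
Qed.

Lemma sequential_bound (c d : R) : c ^+ 2 + d ^+ 2 = 1 ->
  dot (c%:C *: (a0 (b psi) + a1 (b psi) + (a0 (n psi) - a1 (n psi)) - s *: psi)
     + d%:C *: (a0 (m psi) + a1 (m psi) + (a0 (p psi) - a1 (p psi)) - s *: psi))
    psi <= s.
Proof.
move=> cd; have [mE nE] := self_test.
(* By self-testing, the S_1 part equals [s * x + s] and the S_2 part [s + s * y]. After subtracting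
   [s] from each, the claim is that [c * x + d * y] is at most 1. *)
pose x := dot (b psi) (m psi); pose y := dot (p psi) (n psi).
have xE : dot (a0 (b psi)) psi + dot (a1 (b psi)) psi = s * x.
  by rewrite (proj1 a0_sym) (proj1 a1_sym) -dotDr -mE dotZr sJ.
have yE : dot (a0 (p psi)) psi - dot (a1 (p psi)) psi = s * y.
  by rewrite (proj1 a0_sym) (proj1 a1_sym) -dotBr -nE dotZr sJ.
have mm : dot (a0 (m psi)) psi + dot (a1 (m psi)) psi = s.
  by rewrite (proj1 a0_sym) (proj1 a1_sym) -dotDr -mE dotZr sJ isomE psi1 mulr1.
have nn : dot (a0 (n psi)) psi - dot (a1 (n psi)) psi = s.
  by rewrite (proj1 a0_sym) (proj1 a1_sym) -dotBr -nE dotZr sJ isomE psi1 mulr1.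
(* Moving [b] past [a0] and [a1] identifies [x] with its own conjugate; likewise for [y]. Real
   values are needed to compare in the order of [R[i]]. *)
have xR : dot (b (m psi)) psi = x.
  apply: (mulfI s0); rewrite -xE -dotZl -linearZ mE linearD -a0b -a1b dotDl.
  by [].
have yR : dot (p (n psi)) psi = y.
  apply: (mulfI s0); rewrite -yE -dotZl -linearZ nE linearB -a0p -a1p dotBl.
  by [].
have xJ : Num.conj x = x by rewrite -dotC -xR (proj1 b_sym).
have yJ : Num.conj y = y by rewrite -dotC -yR (proj1 p_sym).
(* Multiplying by [s] twice replaces [s *: m psi] and [s *: n psi] by combinations of [a0 psi] and
   [a1 psi]. Mixed terms cancel because [b] and [p] commute; diagonal terms cancel because [a0] and
   [a1] are isometries commuting with both. *)
have anti : dot (b (m psi)) (p (n psi)) + dot (p (n psi)) (b (m psi)) = 0.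
  apply: (mulfI s0); apply: (mulfI s0); rewrite !mulr0 !mulrDr.
  have scale u v : s * (s * dot u v) = dot (s *: u) (s *: v).
    by rewrite dotZl dotZr sJ.
  have bZ : s *: b (m psi) = b (a0 psi) + b (a1 psi).
    by rewrite -linearZ mE linearD.
  have pZ : s *: p (n psi) = p (a0 psi) - p (a1 psi).
    by rewrite -linearZ nE linearB.
  rewrite !scale bZ pZ.
  rewrite !(dotBl, dotBr, dotDl, dotDr).
  have e01 : dot (b (a0 psi)) (p (a1 psi)) = dot (p (a0 psi)) (b (a1 psi)).
    by rewrite -(proj1 p_sym) -bp (proj1 b_sym).
  have e10 : dot (b (a1 psi)) (p (a0 psi)) = dot (p (a1 psi)) (b (a0 psi)).
    by rewrite -(proj1 p_sym) -bp (proj1 b_sym).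
  have e00 : dot (b (a0 psi)) (p (a0 psi)) = dot (b (a1 psi)) (p (a1 psi)).
    by rewrite -!a0b -!a0p -!a1b -!a1p !isomE.
  have e11 : dot (p (a0 psi)) (b (a0 psi)) = dot (p (a1 psi)) (b (a1 psi)).
    by rewrite -!a0b -!a0p -!a1b -!a1p !isomE.
  by rewrite e01 e10 e00 e11; ring.
pose w := c%:C *: b (m psi) + d%:C *: p (n psi).
have wpsi : dot w psi = c%:C * x + d%:C * y by rewrite dotDl !dotZl xR yR.
have psiw : dot psi w = c%:C * x + d%:C * y.
  by rewrite dotC wpsi rmorphD !rmorphM /= xJ yJ !conjC_complex.
have ww : dot w w = 1.
  rewrite /w !(dotDl, dotDr, dotZl, dotZr) !conjC_complex !isomE psi1.
  transitivity ((c ^+ 2 + d ^+ 2)%:C + c%:C * d%:C *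
    (dot (b (m psi)) (p (n psi)) + dot (p (n psi)) (b (m psi)))).
    by rewrite rmorphD !rmorphXn /=; ring.
  by rewrite anti cd mulr0 addr0.
(* For the unit vectors [w] and [psi] with real overlap z, this squared norm is [2 - 2 * z], whence
   z is at most 1. *)
have : 0 <= dot (w - psi) (w - psi) by exact: dnorm_ge0.
rewrite !(dotBl, dotBr) ww psi1 wpsi psiw.
set z := _ + _ * y => z_le.
have z1 : z <= 1.
  rewrite -subr_ge0 -(pmulr_rge0 _ (ltr0Sn _ 1)).
  by apply: le_trans z_le _; rewrite le_eqVlt; apply/orP; left; apply/eqP; ring.
rewrite dotDl !(dotZl _%:C) !dotBl !(dotDl _ (_ - _)) !dotBl !dotDl.
rewrite xE nn mm yE dotZl psi1 mulr1 addrK.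
have -> : s + s * y - s = s * y by ring.
rewrite !(mulrCA _ s) -mulrDr -/z -[leRHS]mulr1 ler_wpM2l//.
by rewrite ler0c sqrtr_ge0.
Qed.

End AbstractBound.

(** * From operators on the factors to operators on the tensor product *)

Section TensorModel.
Context {R : realType} {HA HB : hilbertType R} (T : hilbertTensor HA HB).

(** The square of the representing operator represents the identity, so it is the identity by
    uniqueness. An isometric involution is Hermitian: apply the isometry to [u] and [X v]. *)
Lemma represents_tensor_symmetry (A : {linear HA -> HA}) (B : {linear HB -> HB}) :
  hermitian_op A -> involutive A -> hermitian_op B -> involutive B ->
  exists X : {linear T -> T},
    [/\ represents_tensor A B X, hermitian_op X & involutive X].
Proof.
move=> hA iA hB iB.
have [||X AX nX] := @represents_tensor_exists R HA HB T A B.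
- exact: hermitian_involutive_isometric.
- exact: hermitian_involutive_isometric.
have [lX cX XE] := AX.
pose mX := GRing.isLinear.Build _ _ _ _ X lX.
pose X' : {linear T -> T} := HB.pack X mX.
have iX : involutive X.
  have XX := represents_tensor_comp AX AX.
  have AA : A \o A = idfun by apply/funext => a; exact: iA.
  have BB : B \o B = idfun by apply/funext => b; exact: iB.
  rewrite AA BB in XX.
  move=> u; have := represents_tensor_unique XX (represents_tensor_id T).
  by move=> /(congr1 (@^~ u)).
exists X'; split => // u v.
by rewrite -(linear_isometry_dot lX nX) /= iX.
Qed.

Variables (A : 'I_2 -> {linear HA -> HA}) (B1 : 'I_2 -> {linear HB -> HB})
  (B2 : 'I_2 -> 'I_2 -> {linear HB -> HB}) (psi : T).

Lemma represents_chsh (X0 X1 Y Y' : T -> T) (B B' : HB -> HB) :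
  represents_tensor (A 0) idfun X0 -> represents_tensor (A 1) idfun X1 ->
  represents_tensor idfun B Y -> represents_tensor idfun B' Y' ->
  @chsh R HA HB T A B B' =
    (fun u => X0 (Y u) + X1 (Y u) + (X0 (Y' u) - X1 (Y' u))).
Proof.
move=> X0E X1E YE Y'E.
have XD := represents_tensorD X0E X1E; have XB := represents_tensorB X0E X1E.
rewrite /chsh (tensor_opE (represents_tensor_comp XD YE)).
by rewrite (tensor_opE (represents_tensor_comp XB Y'E)).
Qed.

Lemma expval_S (theta : R) : `|psi| = 1 ->
  expval psi (S_ A B1 B2 theta) =
    (cos (2 * theta))%:C * (expval psi (S_1 A B1) - (Num.sqrt 2)%:C) +
    (sin (2 * theta))%:C * (expval psi (S_2 A B2) - (Num.sqrt 2)%:C).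
Proof.
move=> psi1; rewrite /expval /S_ /= dotDl !dotZl !dotBl !dotZl.
by rewrite -dot_norm psi1 expr1n mulr1.
Qed.

Lemma sequential_model_bound (theta : R) :
  sequential_model psi A B1 B2 ->
  expval psi (S_c A B1 B2) = (2 * Num.sqrt 2)%:C ->
  expval psi (S_ A B1 B2 theta) <= (Num.sqrt 2)%:C.
Proof.
move=> [psi1 hA hB1 hB2 cB].
have liftA x : exists X : {linear T -> T},
    [/\ represents_tensor (A x) idfun X, hermitian_op X & involutive X].
  have [hAx uAx] := hA x; apply: represents_tensor_symmetry => //.
  exact: hermitian_unitary_involutive.
have liftB (B : {linear HB -> HB}) : hermitian_op B /\ unitary_op B ->
    exists X : {linear T -> T},
      [/\ represents_tensor idfun B X, hermitian_op X & involutive X].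
  move=> [hB uB]; apply: represents_tensor_symmetry => //.
  exact: hermitian_unitary_involutive.
have [a0 [a0E ha0 ia0]] := liftA 0; have [a1 [a1E ha1 ia1]] := liftA 1.
have [m [mE hm im]] := liftB _ (hB2 0 0).
have [n [nE hn in_]] := liftB _ (hB1 1).
have [b [bE hb ib]] := liftB _ (hB1 0).
have [p [pE hp ip]] := liftB _ (hB2 0 1).
(* Both orders of composition represent the same pair [C], [D], so they coincide. *)
have comm (C : HA -> HA) (D : HB -> HB) (X Y : T -> T) :
    represents_tensor C idfun X -> represents_tensor idfun D Y ->
    forall u, X (Y u) = Y (X u).
  move=> XE YE u.
  have := represents_tensor_unique (represents_tensor_comp XE YE)
    (represents_tensor_comp YE XE).
  by move=> /(congr1 (@^~ u)).
have bp u : b (p u) = p (b u).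
  have BB : B1 0 \o B2 0 1 = B2 0 1 \o B1 0.
    apply/funext => v; apply/eqP; rewrite -subr_eq0; apply/eqP.
    exact: (cB 0 1 v).
  have := represents_tensor_comp bE pE; rewrite BB => /represents_tensor_unique.
  by move=> /(_ _ (represents_tensor_comp pE bE))/(congr1 (@^~ u)).
rewrite /expval /S_c /S_ /S_1 /S_2 (represents_chsh a0E a1E mE nE).
rewrite (represents_chsh a0E a1E bE nE) (represents_chsh a0E a1E mE pE) /= => hS.
apply: (@sequential_bound _ _ a0 a1 m n b p) => //.
- by move=> u; exact: comm a0E bE u.
- by move=> u; exact: comm a1E bE u.
- by move=> u; exact: comm a0E pE u.
- by move=> u; exact: comm a1E pE u.
- by rewrite -dot_norm psi1 expr1n.
- by rewrite hS rmorphM /= rmorph_nat.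
- by rewrite cos2Dsin2.
Qed.

End TensorModel.

(** * Saturation *)

(* An alias, because matrices already carry the sup norm. *)
Definition euclidean (R : realType) (n : nat) := 'cV[R[i]]_n.

(** * Complex column vectors as a Hilbert space *)

Section Euclidean.
Local Open Scope classical_set_scope.
Context {R : realType} {n : nat}.
Local Notation E := (euclidean R n).
Implicit Types u v : E.

HB.instance Definition _ := Vector.copy E 'cV[R[i]]_n.

Definition cdot u v : R[i] :=
  (map_mx Num.conj (v : 'cV_n)^T *m (u : 'cV_n)) 0 0.

Lemma cdotE u v : cdot u v = \sum_i u i 0 * Num.conj (v i 0).
Proof. by rewrite /cdot mxE; apply: eq_bigr => i _; rewrite !mxE mulrC. Qed.

Lemma cdot_bilinear : bilinear_for (GRing.Scale.Law.clone _ _ *%R _)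
  (GRing.Scale.Law.clone _ _ (Num.conj \; *%R) _) cdot.
Proof.
split=> [v k u u'|v k u u']; rewrite !cdotE /= mulr_sumr -big_split /=;
  apply: eq_bigr => i _; rewrite !mxE.
  by rewrite mulrDl mulrA.
by rewrite rmorphD rmorphM /= mulrDr mulrCA.
Qed.

Lemma cdot_hermitian u v : cdot u v = (-1) ^+ false * Num.conj (cdot v u).
Proof.
rewrite expr0 mul1r !cdotE rmorph_sum; apply: eq_bigr => i _.
by rewrite rmorphM /= conjCK mulrC.
Qed.

Lemma cdot_gt0 u : u != 0 -> 0 < cdot u u.
Proof.
move=> u0; rewrite cdotE lt_def sumr_ge0 ?andbT => [|i _];
  last exact: mul_conjC_ge0.
apply: contraNneq u0 => /eqP; rewrite psumr_eq0 => [/allP u0|i _];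
  last exact: mul_conjC_ge0.
apply/eqP/matrixP => i j; rewrite ord1 mxE; apply/eqP.
by rewrite -mul_conjC_eq0; apply: (u0 i); rewrite mem_index_enum.
Qed.

HB.instance Definition _ :=
  bilinear_isBilinear.Build _ _ _ _ _ _ cdot cdot_bilinear.
HB.instance Definition _ :=
  isHermitianSesquilinear.Build _ _ _ _ cdot cdot_hermitian.
HB.instance Definition _ := isDotProduct.Build _ _ cdot cdot_gt0.

Definition l2norm u := sqrtC (cdot u u).

Lemma l2norm_triangle u v : l2norm (u + v) <= l2norm u + l2norm v.
Proof. exact: (triangle_lerif (cdot : {dot E for Num.conj})). Qed.

Lemma l2normZ (k : R[i]) u : l2norm (k *: u) = `|k| * l2norm u.
Proof.
rewrite /l2norm (dnormZ (cdot : {dot E for Num.conj})).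
by rewrite sqrtCM ?nnegrE ?exprn_ge0 ?sqrCK.
Qed.

Lemma l2norm_eq0 u : l2norm u = 0 -> u = 0.
Proof.
move=> /eqP; rewrite sqrtC_eq0.
by rewrite (dnorm_eq0 (cdot : {dot E for Num.conj})) => /eqP.
Qed.

HB.instance Definition _ :=
  Lmodule_isNormed.Build R[i] E l2norm_triangle l2normZ l2norm_eq0.

Lemma sqr_l2norm u : `|u| ^+ 2 = cdot u u.
Proof. exact: sqrtCK. Qed.

Lemma coord_le_norm u i : `|u i 0| <= `|u|.
Proof.
rewrite -(@ler_pXn2r _ 2)// ?nnegrE// sqr_l2norm cdotE (bigD1 i)//= -normCK.
by rewrite lerDl sumr_ge0// => j _; exact: mul_conjC_ge0.
Qed.

Lemma norm_le_coord u : `|u| <= \sum_i `|u i 0|.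
Proof.
have -> : `|u| = `|\sum_i u i 0 *: (delta_mx i 0 : E)|.
  congr `| _ |; rewrite [LHS](matrix_sum_delta (u : 'cV_n)).
  apply: eq_bigr => i _.
  by rewrite big_ord1.
rewrite (le_trans (ler_norm_sum _ _ _))// ler_sum// => i _.
rewrite normrZ ler_piMr// -(@expr_le1 _ 2)// sqr_l2norm cdotE (bigD1 i)//= big1.
  by rewrite !mxE !eqxx /= conjC1 mulr1 addr0.
by move=> j ji; rewrite !mxE (negPf ji) mul0r.
Qed.

(** Here [g] is the real or the imaginary part. Being 1-Lipschitz in each coordinate, it carries a
    Cauchy filter to one on [R], so that completeness of [R] yields the limit. *)
Let coord_cvg (F : set_system E) (g : R[i] -> R) : ProperFilter F ->
  (forall z w, `|g z - g w|%:C <= `|z - w|) -> cauchy F ->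
  forall i, exists l : R, (fun x : E => g (x i 0)) @ F --> l.
Proof.
move=> FF g1 Fc i; apply/cvg_ex; apply: cauchy_cvg; apply: cauchy_exP => e e0.
have e0' : 0 < e%:C by rewrite ltcR.
have [x Fx] := (cauchyP F).1 Fc _ e0'.
exists (g (x i 0)).
suff : F [set y : E | ball (g (x i 0)) e (g (y i 0))] by [].
apply: filterS Fx => y; rewrite -!ball_normE /= => xy.
rewrite -ltcR; apply: le_lt_trans xy; apply: (le_trans (g1 _ _)).
by have := coord_le_norm (x - y) i; rewrite !mxE.
Qed.

Let Re_lip (z w : R[i]) : `|complex.Re z - complex.Re w|%:C <= `|z - w|.
Proof. by rewrite -raddfB; exact: normc_ge_Re. Qed.

Let Im_lip (z w : R[i]) : `|complex.Im z - complex.Im w|%:C <= `|z - w|.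
Proof.
have -> : complex.Im z - complex.Im w = - complex.Re ((z - w) * 'i%C).
  by rewrite ReiNIm opprK; case: z; case: w.
rewrite normrN (le_trans (normc_ge_Re _))//.
by rewrite normrM complexiE normCi mulr1.
Qed.

Let norm_le_ReIm (z : R[i]) : `|z| <= (`|complex.Re z| + `|complex.Im z|)%:C.
Proof.
have normR (x : R) : `|x%:C| = `|x|%:C.
  by rewrite normc_def /= expr0n addr0 sqrtr_sqr.
rewrite {1}[z]complexE (le_trans (ler_normD _ _))//.
by rewrite normrM complexiE normCi mul1r !normR rmorphD.
Qed.

Lemma euclidean_complete (F : set_system E) :
  ProperFilter F -> cauchy F -> cvg F.
Proof.
move=> FF Fc.
have [l1 l1F] := choice (coord_cvg FF Re_lip Fc).
have [l2 l2F] := choice (coord_cvg FF Im_lip Fc).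
apply/cvg_ex; exists (\col_i (l1 i +i* l2 i) : 'cV_n).
apply/cvgrPdist_lt => e e0.
(* A positive [e] in [R[i]] is real, so the estimate can be carried out in [R]. *)
have eE : (complex.Re e)%:C = e by rewrite RRe_real// gtr0_real.
have e0' : 0 < complex.Re e by rewrite -ltcR eE.
(* The norm is at most the sum of [n] coordinate errors, each below [2 * d]. The denominator
   [2n + 1] makes the total strictly smaller than [e] and stays nonzero for [n = 0]. *)
pose d := complex.Re e / (n.*2.+1)%:R.
have d0 : 0 < d by rewrite divr_gt0.
have near1 : \forall x \near F, forall i,
    `|l1 i - complex.Re ((x : E) i 0)| < d.
  by apply: filter_forall => i; move/cvgrPdist_lt: (l1F i); exact.
have near2 : \forall x \near F, forall i,
    `|l2 i - complex.Im ((x : E) i 0)| < d.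
  by apply: filter_forall => i; move/cvgrPdist_lt: (l2F i); exact.
near=> x.
have x1 : forall i, `|l1 i - complex.Re (x i 0)| < d by near: x.
have x2 : forall i, `|l2 i - complex.Im (x i 0)| < d by near: x.
apply: (le_lt_trans (norm_le_coord _)).
apply: (@le_lt_trans _ _ (\sum_(i < n) (d + d)%:C)).
  apply: ler_sum => i _; apply: (le_trans (norm_le_ReIm _)).
  by rewrite lecR !mxE raddfB raddfB /= lerD// ltW.
rewrite sumr_const card_ord -rmorphMn -eE ltcR -mulr2n -mulrnA mul2n.
rewrite -mulr_natr /d mulrAC ltr_pdivrMr ?ltr0n// ltr_pM2l// ltr_nat.
by rewrite ltnS leqnn.
Unshelve. all: by end_near. Qed.

HB.instance Definition _ := Uniform_isComplete.Build E euclidean_complete.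
HB.instance Definition _ := NormedModule_isHilbert.Build R E sqr_l2norm.

End Euclidean.

Local Notation "A *t B" := (tensmx A B)
  (at level 40, left associativity, format "A  *t  B").

(** * The Kronecker product as a Hilbert tensor product *)

Section EuclideanTensor.
Local Open Scope classical_set_scope.
Context {R : realType} {m p : nat}.

Definition kron (a : euclidean R m) (b : euclidean R p) : euclidean R (m * p) :=
  (a : 'cV_m) *t (b : 'cV_p).

Lemma kron_bilinear :
  bilinear_for (GRing.Scale.Law.clone _ _ *:%R _)
    (GRing.Scale.Law.clone _ _ *:%R _) kron.
Proof.
split=> [b k a a'|a k b b']; apply/matrixP => i j; rewrite !mxE.
  by rewrite mulrDl mulrA.
by rewrite mulrDr mulrCA.
Qed.

HB.instance Definition _ :=
  bilinear_isBilinear.Build _ _ _ _ _ _ kron kron_bilinear.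

Lemma dot_kron a b a' b' : dot (kron a b) (kron a' b') = dot a a' * dot b b'.
Proof.
pose conjT k (u : 'cV[R[i]]_k) := map_mx Num.conj u^T.
(* The columns of [kron a b] are indexed by ['I_(1 * 1)], which is only
   convertible to ['I_1]: rewriting has to precede the cast. *)
have E : map_mx Num.conj (a' *t b')^T *m (a *t b) =
    (conjT _ a' *m a) *t (conjT _ b' *m b).
  by rewrite /conjT trmx_tens map_mxT tensmx_mul.
transitivity (((conjT _ a' *m a) *t (conjT _ b' *m b) : 'M[R[i]]_1) 0 0).
  by rewrite -E.
by rewrite mxE; congr (_ * _); congr fun_of_matrix; rewrite ord1.
Qed.

(** In finite dimension the span is everything: each vector is expanded in the product basis,
    indexed through [mxtens_unindex]. *)
Lemma dense_kron : dense [set u : euclidean R (m * p) |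
  exists n (a : 'I_n -> euclidean R m) (b : 'I_n -> euclidean R p),
    u = \sum_i kron (a i) (b i)].
Proof.
move=> O [u Ou] _; exists u; split=> //=.
exists (m * p)%N, (fun k => u k 0 *: (delta_mx (mxtens_unindex k).1 0 : 'cV_m)),
  (fun k => delta_mx (mxtens_unindex k).2 0 : 'cV_p).
apply/matrixP => i j; rewrite !ord1 summxE (bigD1 i)//= big1 ?addr0.
  by rewrite !mxE !eqxx !ord1 !mulr1.
move=> k ki; rewrite !mxE !ord1 !eqxx !andbT.
have [e1|] := eqVneq (mxtens_unindex i).1 (mxtens_unindex k).1;
  last by rewrite mulr0 mul0r.
have [e2|] := eqVneq (mxtens_unindex i).2 (mxtens_unindex k).2;
  last by rewrite mulr0.
case/eqP: ki; apply: (can_inj (@mxtens_unindexK m p)).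
by rewrite [LHS]surjective_pairing -e1 -e2 -surjective_pairing.
Qed.

Definition euclidean_tensor : hilbertTensor (euclidean R m) (euclidean R p) :=
  HilbertTensor dot_kron dense_kron.

End EuclideanTensor.

(** * Operators given by real matrices *)

Section MatrixOperator.
Context {R : realType}.

(** Real entries suffice for the saturating strategy, and make the adjoint the plain transpose. *)
Definition mxop n (M : 'M[R]_n) (u : euclidean R n) : euclidean R n :=
  map_mx (real_complex R) M *m (u : 'cV_n).

Lemma mxop_linear n (M : 'M[R]_n) : linear (mxop M).
Proof. by move=> k u v; rewrite /mxop [LHS]linearP. Qed.

HB.instance Definition _ n (M : 'M[R]_n) :=
  GRing.isLinear.Build _ _ _ _ (mxop M) (mxop_linear M).

Lemma mxopM n (M N : 'M[R]_n) u : mxop M (mxop N u) = mxop (M *m N) u.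
Proof. by rewrite /mxop mulmxA map_mxM. Qed.

Lemma mxop1 n u : @mxop n 1%:M u = u.
Proof. by rewrite /mxop map_mx1 mul1mx. Qed.

Definition symmetry n (M : 'M[R]_n) := M^T = M /\ M *m M = 1%:M.

Lemma mxop_hermitian n (M : 'M[R]_n) : M^T = M -> hermitian_op (mxop M).
Proof.
move=> MT u v; rewrite /dot /= /cdot /mxop trmx_mul map_mxM -mulmxA.
congr ((_ *m (_ *m _)) 0 0); apply/matrixP => i j.
by rewrite !mxE /= conjC_complex -[M in RHS]MT mxE.
Qed.

Lemma mxop_symmetry n (M : 'M[R]_n) :
  symmetry M -> hermitian_op (mxop M) /\ unitary_op (mxop M).
Proof.
move=> [MT MM]; have hM := mxop_hermitian MT.
by split=> //; exists (mxop M); split=> // u; rewrite mxopM MM mxop1.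
Qed.

Lemma tens1mx1 m n : (1%:M : 'M[R]_m) *t (1%:M : 'M[R]_n) = 1%:M.
Proof.
apply/matrixP => i j; rewrite !mxE -natrM mulnb -[in RHS](mxtens_unindexK i).
rewrite -[in RHS](mxtens_unindexK j) (inj_eq (can_inj (@mxtens_indexK m n))).
by rewrite -xpair_eqE -!surjective_pairing.
Qed.

Lemma tens_symmetry m n (M : 'M[R]_m) (N : 'M[R]_n) :
  symmetry M -> symmetry N -> symmetry (M *t N).
Proof.
move=> [MT MM] [NT NN]; split; first by rewrite trmx_tens MT NT.
by rewrite tensmx_mul MM NN tens1mx1.
Qed.

Definition ket n (i : 'I_n) : euclidean R n := (delta_mx i 0 : 'cV_n).

Lemma dot_mxop_ket n (M : 'M[R]_n) i j :
  dot (mxop M (ket i)) (ket j) = (M j i)%:C.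
Proof.
rewrite /dot /= /cdot /mxop /ket trmx_delta map_delta_mx -colE -rowE.
by rewrite !mxE.
Qed.

Lemma mxop_kron m n (M : 'M[R]_m) (N : 'M[R]_n) a b :
  mxop (M *t N) (kron a b) = kron (mxop M a) (mxop N b).
Proof.
rewrite /mxop map_mxT.
exact: (@tensmx_mul _ _ _ _ _ 1 1 _ _ (a : 'cV_m) (b : 'cV_n)).
Qed.

End MatrixOperator.

(** * The Bell state and the saturating strategy *)

Section Saturation.
Context {R : realType}.

(** This is [a] sigma_z + [b] sigma_x, the qubit observable with Bloch vector ([a], [b]). *)
Definition reflection (a b : R) : 'M[R]_2 :=
  \matrix_(i, j) if i == j then if i == 0 then a else - a else b.

Lemma reflection_symmetry a b : a ^+ 2 + b ^+ 2 = 1 -> symmetry (reflection a b).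
Proof.
move=> ab; split; apply/matrixP => i j; rewrite !mxE; first by case: eqVneq => [->|].
rewrite !big_ord_recl big_ord0 !mxE.
by case: i => -[|[|//]] ?; case: j => -[|[|//]] ?; rewrite /= -?ab; ring.
Qed.

(** The anticommutator of two such observables is twice the inner product of their Bloch vectors,
    times the identity. *)
Lemma reflection_anticomm a b c d : a * c + b * d = 0 ->
  reflection a b *m reflection c d = - (reflection c d *m reflection a b).
Proof.
move=> abcd; apply/matrixP => i j; rewrite !mxE !big_ord_recl !big_ord0 !mxE.
by case: i => -[|[|//]] ?; case: j => -[|[|//]] ?; rewrite /=; lra.
Qed.

Local Notation qubit := (euclidean R 2).
Local Notation T := (@euclidean_tensor R 2 (2 * 2)).

Definition bell_state : T :=
  ((Num.sqrt 2)^-1)%:C *: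
    \sum_(i < 2) kron (ket i) (kron (ket i) (ket (0 : 'I_2))).

(** The maximally entangled pair contributes tr(P^T Q)/2, and the ancilla in state |0> contributes
    [S 0 0]. For reflections the first factor is the inner product of the Bloch vectors. *)
Lemma bell_expectation (P Q S : 'M[R]_2) (X : T -> T) :
  represents_tensor (mxop P) (mxop (Q *t S)) X ->
  expval bell_state X =
  ((\sum_(i < 2) \sum_(j < 2) P j i * Q j i) * S 0 0 / 2)%:C.
Proof.
move=> [lX cX XE].
have X0 : X 0 = 0 by have := lX (-1) 0 0; rewrite scaler0 addr0 scaleN1r addNr.
have XZ k u : X (k *: u) = k *: X u by rewrite -[k *: u]addr0 lX X0 addr0.
rewrite /expval /bell_state XZ linear_fun_sum// dotZl dotZr conjC_complex.
rewrite mulrA dot_sum.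
transitivity (((Num.sqrt 2)^-1)%:C * ((Num.sqrt 2)^-1)%:C *
    \sum_(i < 2) \sum_(j < 2) (P j i * (Q j i * S 0 0))%:C : R[i]).
  congr (_ * _); apply: eq_bigr => i _; apply: eq_bigr => j _.
  by rewrite XE mxop_kron [LHS]dot_kron dot_kron !dot_mxop_ket !rmorphM.
rewrite !big_ord_recl !big_ord0 !addr0 -!(rmorphD, rmorphM) /= -invfM -expr2.
by rewrite sqr_sqrtr//; congr (_%:C); field.
Qed.

Lemma bell_correlation (a b c d : R) (S : 'M[R]_2) (X : T -> T) :
  represents_tensor (mxop (reflection a b)) (mxop (reflection c d *t S)) X ->
  expval bell_state X = ((a * c + b * d) * S 0 0)%:C.
Proof.
move=> /bell_expectation ->; rewrite !big_ord_recl !big_ord0 !mxE /=.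
by congr (_%:C); field.
Qed.

Lemma bell_state_unit : `|bell_state| = 1.
Proof.
apply/eqP; rewrite -(@sqrp_eq1 _ `|_|)// dot_norm; apply/eqP.
(* The squared norm is the expectation of the identity, which represents identity matrices on all
   three qubits. *)
have -> : dot bell_state bell_state = expval bell_state idfun by [].
rewrite (@bell_expectation 1%:M 1%:M 1%:M).
  rewrite !big_ord_recl !big_ord0 !mxE /= -[RHS]/(1%:C).
  by congr (_%:C); field.
split=> [//|u|a b]; first exact: cvg_id.
by rewrite tens1mx1 !mxop1.
Qed.

Lemma bell_chsh (A : 'I_2 -> {linear qubit -> qubit})
    (B B' : {linear euclidean R (2 * 2) -> euclidean R (2 * 2)})
    (a b a' b' c d c' d' : R) (S S' : 'M[R]_2) :
  (forall x, hermitian_op (A x) /\ unitary_op (A x)) ->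
  hermitian_op B /\ unitary_op B -> hermitian_op B' /\ unitary_op B' ->
  A 0 =1 mxop (reflection a b) -> A 1 =1 mxop (reflection a' b') ->
  B =1 mxop (reflection c d *t S) -> B' =1 mxop (reflection c' d' *t S') ->
  expval bell_state (chsh A B B') =
    (((a + a') * c + (b + b') * d) * S 0 0 +
     ((a - a') * c' + (b - b') * d') * S' 0 0)%:C.
Proof.
move=> hA [hB uB] [hB' uB'] A0E A1E BE B'E.
have iA x : involutive (A x).
  by have [hAx uAx] := hA x; exact: hermitian_unitary_involutive.
have iB := hermitian_unitary_involutive hB uB.
have iB' := hermitian_unitary_involutive hB' uB'.
have id_herm (H : hilbertType R) : hermitian_op (idfun : H -> H) by [].
have [X0 [X0E _ _]] := represents_tensor_symmetry T
  (proj1 (hA 0)) (iA 0) (id_herm _) (fun=> erefl).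
have [X1 [X1E _ _]] := represents_tensor_symmetry T
  (proj1 (hA 1)) (iA 1) (id_herm _) (fun=> erefl).
have [Y [YE _ _]] := represents_tensor_symmetry T
  (id_herm _) (fun=> erefl) hB iB.
have [Y' [Y'E _ _]] := represents_tensor_symmetry T
  (id_herm _) (fun=> erefl) hB' iB'.
rewrite (represents_chsh X0E X1E YE Y'E).
have := represents_tensor_comp X0E YE.
have := represents_tensor_comp X1E YE.
have := represents_tensor_comp X0E Y'E.
have := represents_tensor_comp X1E Y'E.
rewrite (funext A0E) (funext A1E) (funext BE) (funext B'E).
move=> /bell_correlation e1 /bell_correlation e2.
move=> /bell_correlation e3 /bell_correlation e4.
rewrite /expval /comp in e1 e2 e3 e4 *.
rewrite !(dotBl, dotDl) e1 e2 e3 e4 -!(rmorphB, rmorphD) /=.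
by congr (_%:C); ring.
Qed.

Lemma saturation (theta : R) :
  exists (HA HB : hilbertType R) (T : hilbertTensor HA HB) (psi : T)
      (A : 'I_2 -> {linear HA -> HA}) (B1 : 'I_2 -> {linear HB -> HB})
      (B2 : 'I_2 -> 'I_2 -> {linear HB -> HB}),
    [/\ sequential_model psi A B1 B2,
        expval psi (S_c A B1 B2) = (2 * Num.sqrt 2)%:C &
        expval psi (S_ A B1 B2 theta) = (Num.sqrt 2)%:C].
Proof.
pose r : R := (Num.sqrt 2)^-1.
have rr : r ^+ 2 = 2^-1 by rewrite /r exprVn sqr_sqrtr.
have r2 : r + r = Num.sqrt 2.
  rewrite -[Num.sqrt 2](mulfK (_ : Num.sqrt 2 != 0))// -/r.
  by rewrite -expr2 sqr_sqrtr// mulrDl mul1r.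
pose c := cos (2 * theta); pose s := sin (2 * theta).
have cs : c ^+ 2 + s ^+ 2 = 1 by exact: cos2Dsin2.
pose Z := reflection 1 0; pose X := reflection 0 1.
have symZ : symmetry Z.
  by apply: reflection_symmetry; rewrite expr1n expr0n addr0.
have symX : symmetry X.
  by apply: reflection_symmetry; rewrite expr1n expr0n add0r.
have symU : symmetry (reflection c s) by exact: reflection_symmetry.
have symV : symmetry (reflection s (- c)).
  by apply: reflection_symmetry; rewrite sqrrN addrC.
have sym1 n : @symmetry R n 1%:M by split; rewrite ?trmx1 ?mulmx1.
(* These are (sigma_z + sigma_x)/sqrt 2 and (sigma_z - sigma_x)/sqrt 2, so that A_0 + A_1 and A_0 -
   A_1 are sqrt 2 times [Z] and [X]. *)
pose A (x : 'I_2) : {linear qubit -> qubit} :=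
  mxop (reflection r (if x == 0 then r else - r)).
pose b1 (y : 'I_2) := if y == 0 then Z *t reflection c s else X *t 1%:M.
pose b2 (y1 y2 : 'I_2) := if y1 == 0 then
    if y2 == 0 then Z *t 1%:M else X *t reflection s (- c)
  (* For [y1 = 1] the identity is chosen, which commutes with [b1 1]. *)
  else 1%:M.
pose B1 (y : 'I_2) : {linear euclidean R (2 * 2) -> euclidean R (2 * 2)} :=
  mxop (b1 y).
pose B2 (y1 y2 : 'I_2) : {linear euclidean R (2 * 2) -> euclidean R (2 * 2)} :=
  mxop (b2 y1 y2).
have hA x : hermitian_op (A x) /\ unitary_op (A x).
  apply: mxop_symmetry; apply: reflection_symmetry.
  by case: ifP => _; rewrite ?sqrrN rr -mulr2n -(mulr_natr 2^-1) mulVf.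
have hB1 y : hermitian_op (B1 y) /\ unitary_op (B1 y).
  by apply: mxop_symmetry; rewrite /b1; case: ifP => _; exact: tens_symmetry.
have hB2 y1 y2 : hermitian_op (B2 y1 y2) /\ unitary_op (B2 y1 y2).
  apply: mxop_symmetry; rewrite /b2; case: ifP => _ //.
  by case: ifP => _; exact: tens_symmetry.
have b12 y1 y2 : b1 y1 *m b2 y1 y2 = b2 y1 y2 *m b1 y1.
  rewrite /b1 /b2; case: ifP => _; last by rewrite mulmx1 mul1mx.
  case: ifP => _; first by rewrite !tensmx_mul mulmx1 mul1mx.
  (* For [y1 = 0], [y2 = 1] both tensor factors anticommute, and the two signs cancel. *)
  rewrite !tensmx_mul reflection_anticomm; last by rewrite mulr0 mul0r addr0.
  rewrite (@reflection_anticomm c); last by rewrite mulrN mulrC subrr.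
  by apply/matrixP => i j; rewrite !mxE mulrNN.
exists qubit, (euclidean R (2 * 2)), T, bell_state, A, B1, B2; split.
- split=> // [|y1 y2 u]; first exact: bell_state_unit.
  by rewrite /commutator /= !mxopM b12 subrr.
- rewrite /S_c (bell_chsh hA (hB2 0 0) (hB1 1)
    (frefl _) (frefl _) (frefl _) (frefl _)).
  rewrite !mxE /=; congr (_%:C); rewrite -r2; ring.
- rewrite (expval_S _ _ _ _ bell_state_unit) /S_1 /S_2 -/c -/s.
  rewrite (bell_chsh hA (hB1 0) (hB1 1)
    (frefl _) (frefl _) (frefl _) (frefl _)).
  rewrite (bell_chsh hA (hB2 0 0) (hB2 0 1)
    (frefl _) (frefl _) (frefl _) (frefl _)).
  rewrite !mxE /= -!(rmorphB, rmorphM, rmorphD); congr (_%:C).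
  (* The ancilla entries are [c] and [s], so S_1 and S_2 have expectations sqrt 2 times [c + 1] and
     [s + 1]; the weights [c] and [s] then produce [c ^+ 2 + s ^+ 2]. *)
  transitivity ((r + r) * (c ^+ 2 + s ^+ 2)); last by rewrite cs mulr1.
  rewrite -r2 /=; ring.
Qed.

End Saturation.

(* The order of R[i]: z <= w means that w - z is a nonnegative real. *)
Theorem mainTheorem1 (R : realType) :
  (forall (HA HB : hilbertType R) (T : hilbertTensor HA HB) (psi : T)
      (A : 'I_2 -> {linear HA -> HA}) (B1 : 'I_2 -> {linear HB -> HB})
      (B2 : 'I_2 -> 'I_2 -> {linear HB -> HB}),
    sequential_model psi A B1 B2 ->
    expval psi (S_c A B1 B2) = (2 * Num.sqrt 2)%:C ->
    forall theta : R,
      expval psi (S_ A B1 B2 theta) <= (Num.sqrt 2)%:C)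
  /\
  (forall theta : R,
    exists (HA HB : hilbertType R) (T : hilbertTensor HA HB) (psi : T)
      (A : 'I_2 -> {linear HA -> HA}) (B1 : 'I_2 -> {linear HB -> HB})
      (B2 : 'I_2 -> 'I_2 -> {linear HB -> HB}),
    [/\ sequential_model psi A B1 B2,
        expval psi (S_c A B1 B2) = (2 * Num.sqrt 2)%:C &
        expval psi (S_ A B1 B2 theta) = (Num.sqrt 2)%:C]).
Proof.
split=> [HA HB T psi A B1 B2 model max theta|theta].
  exact: sequential_model_bound.
exact: saturation.
Qed.
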